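(* Let $g_0(u)=\log(\sqrt u\,I_0(u))$ for $u>0$ and $r_0(u)=I_0'(u)/I_0(u)$. Then $$g_0''(10)=\frac{199}{200}-\frac{r_0(10)}{10}-r_0(10)^2\ge\frac{9831}{100000000}>0.$$
   Context: $I_0$ is the modified Bessel function of the first kind of order $0$: $I_0(u)=\sum_{k\ge0}\frac{(u/2)^{2k}}{(k!)^2}$. *)

(* Defs.v *)
From Stdlib Require Import Reals Factorial.
From Coquelicot Require Import Coquelicot.

Open Scope R_scope.

(* Modified Bessel function of the first kind, of order 0. *)
Definition I0 (u : R) : R :=
  Series (fun k : nat => (u / 2) ^ (2 * k) / (INR (fact k)) ^ 2).

(* [ln] and [sqrt] are total: the values of [g0] are meaningful for 0 < u only. *)
Definition g0 (u : R) : R := ln (sqrt u * I0 u).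

Definition r0 (u : R) : R := Derive I0 u / I0 u.

(* Main.v *)
Require Import Defs.
From Stdlib Require Import Reals Lra Lia Factorial.
From Coquelicot Require Import Coquelicot.

(** Write [I0 u = F (u ^ 2 / 4)] with [F] the entire power series
    [sum x ^ k / (k!) ^ 2].  The recurrence [a k = (k + 1) ^ 2 * a (k + 1)] of its
    coefficients is the differential equation [x F'' + F' = F], which becomes
    Bessel's equation [I0'' = I0 - I0' / u].  Hence [r0' = 1 - r0 / u - r0 ^ 2],
    and since [g0 = ln u / 2 + ln I0] on the positive axis, the second derivative
    of [g0] at [u] is [1 - 1 / (2 u ^ 2) - r0 / u - r0 ^ 2].

    For the inequality, [c = 9487 / 10000] is exactly the positive root of
    [199 / 200 - c / 10 - c ^ 2 = 9831 / 100000000], so it remains to prove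
    [0 <= r0 10 <= c].  The upper bound says [5 F' 25 <= c F 25], where
    [r0 10 = 5 F' 25 / F 25].  No error estimate for truncated series is needed:
    termwise, [c F 25 - 5 F' 25 = sum (c - 5 / (k + 1)) 25 ^ k / (k!) ^ 2], whose
    terms are nonnegative from [k = 5] on, so that one positive partial sum
    settles the sign ([comparison_partial_sum_pos], [partial_sum_le_Series]). *)

Open Scope R_scope.

(** * The power series behind [I0] *)

Definition bessel_coeff (k : nat) : R := / (INR (fact k)) ^ 2.

Lemma bessel_coeff_pos k : 0 < bessel_coeff k.
Proof. apply Rinv_0_lt_compat, pow_lt, INR_fact_lt_0. Qed.

Lemma bessel_coeff_S k : bessel_coeff (S k) = bessel_coeff k / (INR (S k)) ^ 2.
Proof.
  unfold bessel_coeff.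
  rewrite fact_simpl, mult_INR.
  field; split; [apply INR_fact_neq_0 | apply not_0_INR; lia].
Qed.

Lemma CV_radius_bessel_coeff : CV_radius bessel_coeff = p_infty.
Proof.
  apply CV_radius_infinite_DAlembert.
  - intros k; apply Rgt_not_eq, bessel_coeff_pos.
  - apply is_lim_seq_ext with (fun k => / INR (S k) * / INR (S k)).
    + intros k.
      assert (0 < INR (S k)) by (apply lt_0_INR; lia).
      pose proof (bessel_coeff_pos k).
      rewrite bessel_coeff_S, Rabs_pos_eq.
      * field; lra.
      * apply Rlt_le; repeat apply Rdiv_lt_0_compat; auto; apply pow_lt; auto.
    + replace (Finite 0) with (Finite (0 * 0)) by (f_equal; ring).
      assert (L : is_lim_seq (fun k => / INR (S k)) 0).
      { apply (is_lim_seq_incr_1 (fun k => / INR k) 0).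
        apply (is_lim_seq_inv INR p_infty); [apply is_lim_seq_INR | discriminate]. }
      apply (is_lim_seq_mult' _ _ 0 0 L L).
Qed.

Lemma lt_CV_radius_infinite (a : nat -> R) (x : R) :
  CV_radius a = p_infty -> Rbar_lt (Rabs x) (CV_radius a).
Proof. intros ->; exact I. Qed.

Lemma CV_radius_derive_bessel_coeff : CV_radius (PS_derive bessel_coeff) = p_infty.
Proof. rewrite CV_radius_derive; apply CV_radius_bessel_coeff. Qed.

Lemma I0_PSeries u : I0 u = PSeries bessel_coeff (u ^ 2 / 4).
Proof.
  apply Series_ext; intros k.
  unfold bessel_coeff. rewrite pow_mult.
  replace ((u / 2) ^ 2) with (u ^ 2 / 4) by field.
  unfold Rdiv; ring.
Qed.

(** The coefficient form of [x F'' + F' = F]. *)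
Lemma bessel_coeff_recurrence k :
  PS_plus (PS_incr_1 (PS_derive (PS_derive bessel_coeff)))
          (PS_derive bessel_coeff) k = bessel_coeff k.
Proof.
  destruct k as [|k].
  - change (0 + INR 1 * bessel_coeff 1 = bessel_coeff 0).
    rewrite bessel_coeff_S; simpl; field.
  - change (INR (S k) * (INR (S (S k)) * bessel_coeff (S (S k)))
              + INR (S (S k)) * bessel_coeff (S (S k)) = bessel_coeff (S k)).
    rewrite (bessel_coeff_S (S k)), (S_INR (S k)).
    pose proof (pos_INR (S k)). field; lra.
Qed.

Lemma bessel_PSeries_ode x :
  x * PSeries (PS_derive (PS_derive bessel_coeff)) x
    + PSeries (PS_derive bessel_coeff) x = PSeries bessel_coeff x.
Proof.
  rewrite <- (PSeries_ext _ _ x bessel_coeff_recurrence), PSeries_plus, PSeries_incr_1.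
  - reflexivity.
  - apply ex_pseries_incr_1, ex_pseries_derive, lt_CV_radius_infinite.
    apply CV_radius_derive_bessel_coeff.
  - apply ex_pseries_derive, lt_CV_radius_infinite, CV_radius_bessel_coeff.
Qed.

(** * Derivatives of [I0], [r0] and [g0] *)

Definition I0' (u : R) : R := u / 2 * PSeries (PS_derive bessel_coeff) (u ^ 2 / 4).

Lemma is_derive_I0 u : is_derive I0 u (I0' u).
Proof.
  apply is_derive_ext with (fun v => PSeries bessel_coeff (v ^ 2 / 4)).
  { intros; symmetry; apply I0_PSeries. }
  apply (is_derive_comp (PSeries bessel_coeff) (fun v => v ^ 2 / 4) u
           (PSeries (PS_derive bessel_coeff) (u ^ 2 / 4)) (u / 2)).
  - apply is_derive_PSeries, lt_CV_radius_infinite, CV_radius_bessel_coeff.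
  - auto_derive; [exact I | field].
Qed.

(** Bessel's equation: with [x = u ^ 2 / 4] the chain rule gives
    [I0'' = F' / 2 + x F''], and [x F'' = F - F'] while [F' / 2 = I0' / u]. *)
Lemma is_derive_I0' u : u <> 0 -> is_derive I0' u (I0 u - I0' u / u).
Proof.
  intros Hu.
  set (f1 := PSeries (PS_derive bessel_coeff) (u ^ 2 / 4)).
  set (f2 := PSeries (PS_derive (PS_derive bessel_coeff)) (u ^ 2 / 4)).
  replace (I0 u - I0' u / u) with (/ 2 * f1 + u / 2 * (u / 2 * f2)).
  - apply (is_derive_mult (fun v => v / 2)
             (fun v => PSeries (PS_derive bessel_coeff) (v ^ 2 / 4)));
      [auto_derive; [exact I | field] | | intros; apply Rmult_comm].
    apply (is_derive_comp (PSeries (PS_derive bessel_coeff)) (fun v => v ^ 2 / 4) u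
             f2 (u / 2)).
    + apply is_derive_PSeries, lt_CV_radius_infinite, CV_radius_derive_bessel_coeff.
    + auto_derive; [exact I | field].
  - rewrite I0_PSeries, <- bessel_PSeries_ode; fold f1 f2.
    unfold I0'; fold f1. field; auto.
Qed.

Lemma r0_eq u : r0 u = I0' u / I0 u.
Proof. unfold r0; now rewrite (is_derive_unique _ _ _ (is_derive_I0 u)). Qed.

Lemma partial_sum_le_Series (a : nat -> R) (n : nat) :
  (forall k, (n < k)%nat -> 0 <= a k) -> ex_series a -> sum_f_R0 a n <= Series a.
Proof.
  intros Ha Hex.
  rewrite (Series_incr_n a (S n)) by (auto; lia); simpl pred.
  assert (H : 0 <= Series (fun k => a (S n + k)%nat)); [|lra].
  rewrite <- (Rmult_0_l (Series (fun k => a (S n + k)%nat))), <- Series_scal_l.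
  apply Series_le.
  - intros k; specialize (Ha (S n + k)%nat ltac:(lia)); lra.
  - now apply ex_series_incr_n.
Qed.

Lemma I0_pos u : 0 < I0 u.
Proof.
  rewrite I0_PSeries; unfold PSeries.
  eapply Rlt_le_trans; [|apply (partial_sum_le_Series _ 0)].
  - simpl; rewrite Rmult_1_r; apply bessel_coeff_pos.
  - intros k _; apply Rmult_le_pos; [apply Rlt_le, bessel_coeff_pos|].
    apply pow_le; pose proof (pow2_ge_0 u); lra.
  - apply ex_pseries_R, CV_radius_inside, lt_CV_radius_infinite, CV_radius_bessel_coeff.
Qed.

Lemma is_derive_g0 u : 0 < u -> is_derive g0 u (/ (2 * u) + r0 u).
Proof.
  intros Hu; pose proof (I0_pos u) as HI.
  apply is_derive_ext_loc with (fun v => / 2 * ln v + ln (I0 v)).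
  - apply (locally_interval _ u 0 p_infty); try easy.
    intros v Hv _; simpl in Hv.
    change (/ 2 * ln v + ln (I0 v) = ln (sqrt v * I0 v)).
    rewrite ln_mult by (try apply I0_pos; now apply sqrt_lt_R0).
    rewrite <- (sqrt_sqrt v) at 1 by lra.
    rewrite ln_mult by (now apply sqrt_lt_R0). field.
  - rewrite r0_eq.
    apply (is_derive_plus (fun v => / 2 * ln v) (fun v => ln (I0 v))).
    + auto_derive; [exact Hu | field; lra].
    + apply (is_derive_comp ln I0 u (/ I0 u) (I0' u)).
      * now apply is_derive_ln.
      * apply is_derive_I0.
Qed.

(** The Riccati equation attached to Bessel's equation. *)
Lemma is_derive_r0 u : 0 < u -> is_derive r0 u (1 - r0 u / u - r0 u ^ 2).
Proof.
  intros Hu; pose proof (I0_pos u) as HI.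
  apply is_derive_ext with (fun v => I0' v / I0 v).
  { intros; symmetry; apply r0_eq. }
  rewrite r0_eq.
  replace (1 - _ - _) with
    (((I0 u - I0' u / u) * I0 u - I0' u * I0' u) / I0 u ^ 2) by (field; lra).
  apply is_derive_div; [apply is_derive_I0'; lra | apply is_derive_I0 | lra].
Qed.

Lemma is_derive_Derive_g0 u :
  0 < u -> is_derive (Derive g0) u (1 - / (2 * u ^ 2) - r0 u / u - r0 u ^ 2).
Proof.
  intros Hu.
  apply is_derive_ext_loc with (fun v => / (2 * v) + r0 v).
  - apply (locally_interval _ u 0 p_infty); try easy.
    intros v Hv _; symmetry; apply is_derive_unique, is_derive_g0, Hv.
  - replace (1 - / (2 * u ^ 2) - r0 u / u - r0 u ^ 2) with
      (- / (2 * u ^ 2) + (1 - r0 u / u - r0 u ^ 2)) by ring.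
    apply (is_derive_plus (fun v => / (2 * v)) r0); [|now apply is_derive_r0].
    auto_derive; [|field]; lra.
Qed.

(** * Bounds for [r0 10] *)

(** The partial sum of [c F 25 - 5 F' 25] is negative up to [k = 10]; the twelve
    terms [k <= 11] are the first ones whose sum is positive. *)
Lemma comparison_partial_sum_pos :
  0 < sum_f_R0
        (fun k => (9487 / 10000 - 5 / INR (S k)) * (bessel_coeff k * 25 ^ k)) 11.
Proof.
  cbn [sum_f_R0].
  rewrite !bessel_coeff_S, !INR_IZR_INZ.
  replace (bessel_coeff 0) with 1 by (unfold bessel_coeff; simpl; field).
  cbn [Z.of_nat Pos.of_succ_nat Pos.succ].
  lra.
Qed.

(** The two series for [I0 10] and [I0' 10] are compared term by term: the
    coefficient of [F'] at [25 ^ k] is [1 / (k + 1)] times that of [F]. *)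
Lemma r0_10_le : r0 10 <= 9487 / 10000.
Proof.
  pose proof (I0_pos 10) as HI.
  rewrite r0_eq; apply Rle_div_l; [exact HI|].
  unfold I0'. revert HI; rewrite I0_PSeries; intros _.
  replace (10 ^ 2 / 4) with 25 by field.
  replace (10 / 2) with 5 by field.
  assert (Ea : ex_series (fun k => bessel_coeff k * 25 ^ k)).
  { apply ex_pseries_R, CV_radius_inside, lt_CV_radius_infinite, CV_radius_bessel_coeff. }
  assert (Eb : ex_series (fun k => PS_derive bessel_coeff k * 25 ^ k)).
  { apply ex_pseries_R, CV_radius_inside, lt_CV_radius_infinite.
    apply CV_radius_derive_bessel_coeff. }
  apply (ex_series_scal_l (K := R_AbsRing) (9487 / 10000)) in Ea.
  apply (ex_series_scal_l (K := R_AbsRing) 5) in Eb.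
  set (d := fun k => 9487 / 10000 * (bessel_coeff k * 25 ^ k)
                     - 5 * (PS_derive bessel_coeff k * 25 ^ k)).
  assert (Ed : ex_series d).
  { exact (ex_series_minus _ _ Ea Eb). }
  assert (Hd : forall k,
             d k = (9487 / 10000 - 5 / INR (S k)) * (bessel_coeff k * 25 ^ k)).
  { intros k; unfold d, PS_derive. rewrite bessel_coeff_S.
    field; apply not_0_INR; lia. }
  assert (Hpos : 0 <= Series d).
  { eapply Rle_trans; [|apply (partial_sum_le_Series d 11); [|exact Ed]].
    - rewrite (sum_eq d _ 11 (fun k _ => Hd k)). apply Rlt_le, comparison_partial_sum_pos.
    - intros k Hk; rewrite Hd; apply Rmult_le_pos.
      + assert (H12 : INR 12 <= INR (S k)) by (apply le_INR; lia).
        simpl INR in H12 at 1.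
        enough (5 / INR (S k) <= 9487 / 10000) by lra.
        apply Rle_div_l; lra.
      + apply Rmult_le_pos; [apply Rlt_le, bessel_coeff_pos | apply pow_le; lra]. }
  unfold d in Hpos.
  rewrite Series_minus, !Series_scal_l in Hpos by assumption.
  unfold PSeries; lra.
Qed.

(** Makes [r0 ^ 2 + r0 / 10] monotone in [r0], so that the upper bound on
    [r0 10] transfers to it. *)
Lemma r0_nonneg u : 0 <= u -> 0 <= r0 u.
Proof.
  intros Hu; rewrite r0_eq.
  apply Rdiv_le_0_compat; [apply Rmult_le_pos; [lra|] | apply I0_pos].
  assert (Ha : forall k, 0 <= PS_derive bessel_coeff k * (u ^ 2 / 4) ^ k).
  { intros k; repeat apply Rmult_le_pos;
      [apply pos_INR | apply Rlt_le, bessel_coeff_pos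
      | apply pow_le; pose proof (pow2_ge_0 u); lra]. }
  apply Rle_trans with (1 := Ha 0%nat).
  apply (partial_sum_le_Series
           (fun k => PS_derive bessel_coeff k * (u ^ 2 / 4) ^ k) 0).
  - intros k _; apply Ha.
  - apply ex_pseries_R, CV_radius_inside, lt_CV_radius_infinite, CV_radius_derive_bessel_coeff.
Qed.

(** * The second derivative of [g0] at [10] *)

(* [Derive_n] is total; the first conjunct says that the second derivative of
   [g0] at 10 exists in the usual sense. *)
Theorem theorem4p2 :
  locally 10 (fun u : R => forall k : nat, (k <= 2)%nat -> ex_derive_n g0 k u) /\
  Derive_n g0 2 10 = 199 / 200 - r0 10 / 10 - (r0 10) ^ 2 /\
  199 / 200 - r0 10 / 10 - (r0 10) ^ 2 >= 9831 / 100000000 /\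
  9831 / 100000000 > 0.
Proof.
  split; [|split; [|split; [|lra]]].
  - apply (locally_interval _ 10 0 p_infty); simpl; try easy; try lra.
    intros u Hu _ [|[|[|k]]] Hk; [exact I | | | lia].
    + eexists; now apply is_derive_g0.
    + eexists; now apply is_derive_Derive_g0.
  - change (Derive (Derive g0) 10 = 199 / 200 - r0 10 / 10 - r0 10 ^ 2).
    rewrite (is_derive_unique _ _ _ (is_derive_Derive_g0 10 ltac:(lra))). field.
  - pose proof r0_10_le. pose proof (r0_nonneg 10 ltac:(lra)). nra.
Qed.
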